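(* For all positive integers $n$ and integers $k\ge 2$, we have $$\det_{0\le i,j\le n-1}\left(\mathcal P_{i+j+1}(0,k)\right)=\begin{cases} (-1)^{k(n_1-1)-1}(xy)^{kn_1(2kn_1-k-3)+k}\,P_{n-k+2,k}(x,y) & \text{if } n=2kn_1-1,\\ (-1)^{kn_1+\binom k2}(xy)^{k(n_1-1)(2kn_1-k+1)}\,P_{n,k}(x,y) & \text{if } n=2kn_1-k+1,\\ (-1)^{kn_1+\binom{k+1}2}(xy)^{k(n_1-1)(2kn_1-k-1)}\,P_{n-k,k}(x,y) & \text{if } n=2kn_1-k,\\ (-1)^{kn_1}(xy)^{kn_1(2kn_1-k-1)}\,P_{n,k}(x,y) & \text{if } n=2kn_1,\\ 0 & \text{if } n\not\equiv 0,k,k+1,2k-1\pmod{2k},\end{cases}$$ where $n_1$ denotes a positive integer and $$P_{m,k}(x,y)=\begin{cases} \dfrac{x^{m+k}+(-1)^{m/k}y^{m+k}}{x^k+y^k} & \text{if } k\mid m,\\[3mm] \dfrac{\left(x^{k\lfloor m/k\rfloor+k}+(-1)^{\lfloor m/k\rfloor}y^{k\lfloor m/k\rfloor+k}\right)\left(x^{m-k\lfloor m/k\rfloor}+(-1)^{\lfloor m/k\rfloor}y^{m-k\lfloor m/k\rfloor}\right)}{x^k+y^k} & \text{if } k\nmid m,\end{cases}$$ while for $k=1$ we have $$\det_{0\le i,j\le n-1}\left(\mathcal P_{i+j+1}(0,1)\right)=\begin{cases} (-1)^{n_1}(xy)^{2n_1(n_1-1)}\,\dfrac{x^{n+1}+(-1)^n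 y^{n+1}}{x+y} & \text{if } n=2n_1,\\[2mm] (-1)^{n_1+1}(xy)^{2(n_1-1)^2}\,\dfrac{x^{n}+(-1)^{n-1}y^{n}}{x+y} & \text{if } n=2n_1-1,\end{cases}$$ and for $k=0$ we have $$\det_{0\le i,j\le n-1}\left(\mathcal P_{i+j+1}(0,0)\right)=2^{n-1}(xy)^{\binom n2}(x^n+y^n).$$
   Context: $x,y$ are indeterminates. A three-step path is a lattice path in $\mathbb Z^2$ consisting of steps from $\{(1,0),(1,1),(1,-1)\}$. The steps have weights $w((1,0))=x+y$, $w((1,1))=1$, $w((1,-1))=xy$, and the weight $w(P)$ of a path $P$ is the product of the weights of its steps (the empty path has weight $1$). For integers $n\ge 0$ and $l,k$, $\mathcal P_n(l,k)=\sum_P w(P)$, where the sum is over all three-step paths $P$ from $(0,l)$ to $(n,k)$ (with no restriction about the $x$-axis). The quotients are to be read as polynomials in $x,y$. For $k=2$ the first two cases coincide and give the same value. *)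

(* Defs.v *)
From HB Require Import structures.
From mathcomp Require Import all_boot all_order all_algebra.
From mathcomp Require Export polyXY.

Set Implicit Arguments.
Unset Strict Implicit.
Unset Printing Implicit Defensive.

Import GRing.Theory.
Local Open Scope ring_scope.

(* Z[x, y]: 'X stands for x, and 'Y (that is, 'X%:P) for y. *)
Notation ZXY := {poly {poly int}}.

Definition steps : seq (int * int) := [:: (1, 0); (1, 1); (1, -1)].

(* The junk value outside of [steps] is never used. *)
Definition step_weight (s : int * int) : ZXY :=
  if s == (1, 0) then 'X + 'Y
  else if s == (1, 1) then 1
  else if s == (1, -1) then 'X * 'Y
  else 0.

Definition path_weight (p : seq (seq_sub steps)) : ZXY :=
  \prod_(s <- p) step_weight (val s).

Definition path_from_to (A B : int * int) (p : seq (seq_sub steps)) : bool :=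
  A + \sum_(s <- p) val s == B.

(* Each step advances the abscissa by 1, so every path from (0, l) to (n, k)
   has exactly n steps. *)
Definition path_gf (n : nat) (l k : int) : ZXY :=
  \sum_(p : n.-tuple (seq_sub steps) | path_from_to (0, l) (n%:Z, k) p)
    path_weight p.

(* [%/] is division of polynomials in x with coefficients in Z[y]. The divisor
   x^k + y^k is monic in x for 0 < k, and Pmk_mulK shows that the quotient is
   exact; taking k = 1 there covers the quotients by x + y. *)
Definition Pmk (m k : nat) : ZXY :=
  let q := (m %/ k)%N in
  if (k %| m)%N then
    ('X ^+ (m + k) + (-1) ^+ q * 'Y ^+ (m + k)) %/ ('X ^+ k + 'Y ^+ k)
  else
    (('X ^+ (k * q + k) + (-1) ^+ q * 'Y ^+ (k * q + k))
     * ('X ^+ (m - k * q) + (-1) ^+ q * 'Y ^+ (m - k * q)))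
    %/ ('X ^+ k + 'Y ^+ k).

Lemma XkYk_monic (k : nat) : (0 < k)%N -> ('X ^+ k + 'Y ^+ k : ZXY) \is monic.
Proof.
move=> k0; rewrite monicE lead_coefDl ?lead_coefXn //.
by rewrite -polyC_exp size_polyXn ltnS (leq_trans (size_polyC_leq1 _)).
Qed.

Lemma addrXX_factor (R : comPzRingType) (a b : R) (q : nat) :
  a ^+ q.+1 + (-1) ^+ q * b ^+ q.+1
  = (\sum_(i < q.+1) a ^+ (q - i) * (- b) ^+ i) * (a + b).
Proof.
rewrite [RHS]mulrC -[X in (_ + X) * _]opprK -(subrXX a (- b) q.+1).
by rewrite [(- b) ^+ _]exprNn [(-1) ^+ q.+1]exprS mulN1r mulNr opprK.
Qed.

Lemma Pmk_mulK (m k : nat) : (0 < k)%N ->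
  let q := (m %/ k)%N in
  Pmk m k * ('X ^+ k + 'Y ^+ k) =
  if (k %| m)%N then 'X ^+ (m + k) + (-1) ^+ q * 'Y ^+ (m + k)
  else ('X ^+ (k * q + k) + (-1) ^+ q * 'Y ^+ (k * q + k))
     * ('X ^+ (m - k * q) + (-1) ^+ q * 'Y ^+ (m - k * q)).
Proof.
move=> k0 q; rewrite /Pmk -/q.
have [r Er] : exists r : ZXY, 'X ^+ (k * q + k) + (-1) ^+ q * 'Y ^+ (k * q + k)
                              = r * ('X ^+ k + 'Y ^+ k).
  by eexists; rewrite addnC -mulnS !exprM; exact: addrXX_factor.
case: ifPn => [/divnK | _].
  rewrite -/q mulnC => <-.
  by rewrite Er Pdiv.IdomainMonic.mulpK ?XkYk_monic.
by rewrite Er mulrAC Pdiv.IdomainMonic.mulpK ?XkYk_monic.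
Qed.

(* Main.v *)
Require Import Defs.
From HB Require Import structures.
From mathcomp Require Import all_boot all_order all_algebra.
From mathcomp Require Import ring zify.
Set Implicit Arguments.
Unset Strict Implicit.
Unset Printing Implicit Defensive.
Import Order.TTheory GRing.Theory Num.Theory.
Local Open Scope ring_scope.

(* Write s = x y and X = x + y + t + t' with t t' = s, and let L_d be the linear
   functional X^i |-> P_i(0,d), that is, the coefficient of t^d. The polynomials
   T_m = t^m + t'^m satisfy 2 s^k L_k(p) = L_0(T_k p). Hence if Q T_k is a
   combination of a few T_m of high degree, then Q is L_k-orthogonal to all small
   powers of X. This applies to
     E = (t^K + t'^K) / (t^k + t'^k)           with K an odd multiple of k,
     O = (t - t') (t^K - t'^K) / (t^k + t'^k)  with K an even multiple of k.
   An orthogonality relation is a linear relation between the rows of a Hankel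
   matrix; by Cramer's rule it turns the shifted determinant into Q(0) times an
   unshifted one, or shows that it vanishes. At X = 0, i.e. t = -x and t' = -y,
   E and O give the polynomials P_{m,k}. In the basis T_m, the unshifted Hankel
   matrix has at most two nonzero entries per row, and its determinant is found
   by splitting off blocks of size 2k. *)
Lemma nat_ind2 (P : nat -> Prop) :
  P 0%N -> P 1%N -> (forall m, P m -> P m.+1 -> P m.+2) -> forall m, P m.
Proof.
by move=> P0 P1 PS m; suff [] : P m /\ P m.+1 by []; elim: m => // m [? ?]; split; auto.
Qed.

(** * Moment functionals and Hankel determinants *)

Section Functional.
Variable R : comNzRingType.

Definition moment_fun (mu : nat -> R) (p : {poly R}) : R :=
  \sum_(i < size p) p`_i * mu i.

(** Padding with zero coefficients lets polynomials of different sizes share one summation bound. *)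
Lemma moment_funE (mu : nat -> R) (N : nat) (p : {poly R}) :
  (size p <= N)%N -> moment_fun mu p = \sum_(i < N) p`_i * mu i.
Proof.
move=> leN; rewrite -(subnKC leN) big_split_ord /= [X in _ + X]big1 ?addr0 //.
by move=> i _; rewrite nth_default ?mul0r ?leq_addr.
Qed.

Lemma moment_fun_is_semilinear (mu : nat -> R) :
  semilinear_for *%R (moment_fun mu).
Proof.
split=> [a p | p q].
  rewrite (moment_funE _ (size_scale_leq a p)) mulr_sumr.
  by apply: eq_bigr => i _; rewrite coefZ mulrA.
rewrite (moment_funE _ (size_polyD p q)) (moment_funE _ (leq_maxl _ (size q))).
rewrite (moment_funE _ (leq_maxr (size p) _)) -big_split /=.
by apply: eq_bigr => i _; rewrite coefD mulrDl.
Qed.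

HB.instance Definition _ (mu : nat -> R) :=
  GRing.isSemilinear.Build R {poly R} R *%R (moment_fun mu)
    (moment_fun_is_semilinear mu).

Lemma moment_fun1 (mu : nat -> R) : moment_fun mu 1 = mu 0%N.
Proof. by rewrite /moment_fun size_poly1 big_ord1 coef1 mul1r. Qed.

Lemma moment_funXn (mu : nat -> R) (n : nat) : moment_fun mu 'X^n = mu n.
Proof.
rewrite /moment_fun size_polyXn big_ord_recr /= coefXn eqxx mul1r big1 ?add0r //.
by move=> i _; rewrite coefXn ltn_eqF ?mul0r.
Qed.

(** The right side is an entry of the coefficient row of [p] times a Hankel matrix, so orthogonality
    to powers of X becomes a relation between rows. *)
Lemma moment_funMXn (mu : nat -> R) (n N : nat) (p : {poly R}) :
  (size p <= N)%N ->
  moment_fun mu (p * 'X^n) = \sum_(i < N) p`_i * mu (i + n)%N.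
Proof.
move=> leN; rewrite (@moment_funE _ (n + N)); last first.
  apply: leq_trans (size_polyMleq _ _) _.
  by rewrite size_polyXn addnS /= addnC leq_add2l.
rewrite big_split_ord /= [X in X + _]big1 ?add0r => [|i _]; last first.
  by rewrite coefMXn ltn_ord mul0r.
by apply: eq_bigr => i _; rewrite coefMXn ltnNge leq_addr addKn addnC.
Qed.

Lemma moment_funM (mu : nat -> R) (N : nat) (p q : {poly R}) :
  (size p <= N)%N -> (size q <= N)%N ->
  moment_fun mu (p * q) = \sum_(i < N) \sum_(j < N) p`_i * mu (i + j)%N * q`_j.
Proof.
move=> lep leq.
have ->: q = \sum_(j < N) q`_j *: 'X^j.
  rewrite -[LHS]coefK poly_def (big_ord_widen N (fun i => q`_i *: 'X^i)) //.
  rewrite big_mkcond; apply: eq_bigr => j _; case: ltnP => // le.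
  by rewrite nth_default ?scale0r.
rewrite mulr_sumr raddf_sum exchange_big /=; apply: eq_bigr => j _.
rewrite -scalerAr linearZ /= (moment_funMXn _ _ lep) mulr_sumr.
apply: eq_bigr => i _; rewrite mulrC; congr (_ * _).
rewrite coef_sum (bigD1 j) //= coefZ coefXn eqxx mulr1 big1 ?addr0 // => l.
by rewrite coefZ coefXn eq_sym -val_eqE => /negbTE->; rewrite mulr0.
Qed.

Definition hankel (mu : nat -> R) (n : nat) : 'M[R]_n :=
  \matrix_(i < n, j < n) mu (i + j)%N.

(** The coefficient matrix of such a basis is unitriangular, and the change of basis is a congruence
    by it. *)
Lemma det_hankel_basis (mu : nat -> R) (n : nat) (T : nat -> {poly R}) :
  (forall i, T i \is monic) -> (forall i, size (T i) = i.+1) ->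
  \det (hankel mu n) = \det (\matrix_(i < n, j < n) moment_fun mu (T i * T j)).
Proof.
move=> mT sT; pose P := \matrix_(i < n, j < n) (T i)`_j.
have detP : \det P = 1.
  rewrite det_trig; first rewrite big1 // => i _.
    by rewrite mxE -[X in _`_X]/(i.+1.-1) -sT -lead_coefE (monicP (mT i)).
  by apply/is_trig_mxP => i j ij; rewrite mxE nth_default ?sT.
have -> : \matrix_(i < n, j < n) moment_fun mu (T i * T j)
          = P *m hankel mu n *m P^T.
  apply/matrixP=> i j; rewrite !mxE (@moment_funM _ n) ?sT //.
  rewrite exchange_big /=; apply: eq_bigr => b _.
  by rewrite !mxE mulr_suml; apply: eq_bigr => a _; rewrite !mxE.
by rewrite !det_mulmx det_tr detP mul1r mulr1.
Qed.

(** Cramer's rule without division: multiplying the relation by the adjugate gives [\det M] times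
    [w] on one side and leaves a single cofactor in the first entry of the other. *)
Lemma det_row_relation (n : nat) (M : 'M[R]_n.+1) (w : 'rV_n.+1) (a : R) :
  w *m M = a *: delta_mx 0 ord_max ->
  w 0 0 * \det M = a * ((-1) ^+ n * \det (row' 0 (col' ord_max M))).
Proof.
move=> wM; have := congr1 (fun v => (v *m \adj M) 0 0) wM.
rewrite -mulmxA mul_mx_adj -scalemxAl -rowE !mxE /cofactor add0n => <-.
rewrite (bigD1 0) //= mxE eqxx mulr1n big1 ?addr0 // => j /negbTE j0.
by rewrite mxE j0 mulr0n mulr0.
Qed.

(** The last column of [M] is left free, because the next two lemmas choose it differently. *)
Lemma hankel_shift_sub (mu : nat -> R) (n : nat) (M : 'M_n.+1) :
  (forall i (j : 'I_n), M i (widen_ord (leqnSn n) j) = mu (i + j)%N) ->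
  row' 0 (col' ord_max M) = hankel (fun i => mu i.+1) n.
Proof.
move=> hM; apply/matrixP=> i j; rewrite !mxE -addSn -[in RHS](lift0 i).
rewrite -hM; congr (M _ _); apply: val_inj => /=.
by rewrite /bump leqNgt ltn_ord.
Qed.

(** The Hankel columns are completed by the last unit vector. This keeps the unshifted determinant
    of size n, and the coefficient row of Q picks out its coefficient of X^n in the new column. *)
Lemma det_hankel_shift_lead (mu : nat -> R) (n : nat) (Q : {poly R}) :
  (size Q <= n.+1)%N ->
  (forall j, (j < n)%N -> moment_fun mu (Q * 'X^j) = 0) ->
  Q`_n * \det (hankel (fun i => mu i.+1) n)
  = (-1) ^+ n * Q`_0 * \det (hankel mu n).
Proof.
move=> sQ orthQ.
pose M : 'M_n.+1 :=
  \matrix_(i, j) (if (j < n)%N then mu (i + j)%N else (i == ord_max)%:R).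
have detM : \det M = \det (hankel mu n).
  rewrite (expand_det_col _ ord_max) (bigD1 ord_max) //= big1 ?addr0 => [|i /negbTE ni].
    rewrite /cofactor mxE ltnn eqxx mul1r addnn -signr_odd odd_double mul1r.
    congr (\det _); apply/matrixP=> i j; rewrite !mxE /= /bump.
    by rewrite !(leqNgt n) !ltn_ord.
  by rewrite mxE ltnn ni mul0r.
have wM : \row_i Q`_i *m M = Q`_n *: delta_mx 0 ord_max.
  apply/rowP=> j; rewrite !mxE eqxx /=.
  under eq_bigr => i _ do rewrite !mxE.
  have [jn|nj] := ltnP j n.
    by rewrite -(moment_funMXn _ _ sQ) orthQ // -val_eqE /= ltn_eqF ?mulr0.
  have ->: j = ord_max by apply: val_inj; apply/eqP; rewrite eqn_leq nj -ltnS ltn_ord.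
  rewrite (bigD1 ord_max) //= eqxx big1 ?addr0 // => i /negbTE->.
  by rewrite mulr0.
have := det_row_relation wM; rewrite detM mxE (@hankel_shift_sub mu).
  by move=> E; rewrite -[RHS]mulrA E [RHS]mulrCA signrMK.
by move=> i j; rewrite mxE /= ltn_ord.
Qed.

(** Here the last column is the genuine Hankel one. This serves when X^n is the first power not
    orthogonal to Q, even if Q has degree below n. *)
Lemma det_hankel_shift_last (mu : nat -> R) (n : nat) (Q : {poly R}) :
  (size Q <= n.+1)%N ->
  (forall j, (j < n)%N -> moment_fun mu (Q * 'X^j) = 0) ->
  moment_fun mu (Q * 'X^n) * \det (hankel (fun i => mu i.+1) n)
  = (-1) ^+ n * Q`_0 * \det (hankel mu n.+1).
Proof.
move=> sQ orthQ.
have wM : \row_i Q`_i *m hankel mu n.+1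
          = moment_fun mu (Q * 'X^n) *: delta_mx 0 ord_max.
  apply/rowP=> j; rewrite !mxE eqxx /=.
  under eq_bigr => i _ do rewrite !mxE.
  rewrite -(moment_funMXn _ _ sQ).
  have [jn|nj] := ltnP j n.
    by rewrite orthQ // -val_eqE /= ltn_eqF ?mulr0.
  have ->: j = ord_max by apply: val_inj; apply/eqP; rewrite eqn_leq nj -ltnS ltn_ord.
  by rewrite eqxx mulr1.
have := det_row_relation wM; rewrite mxE (@hankel_shift_sub mu).
  by move=> E; rewrite -[RHS]mulrA E [RHS]mulrCA signrMK.
by move=> i j; rewrite mxE.
Qed.

End Functional.

(** The coefficients of Q form a nonzero left kernel vector. Column j of the shifted matrix pairs
    with X^(j+1), hence orthogonality up to X^n. *)
Lemma det_hankel_shift_eq0 (R : idomainType) (mu : nat -> R) (n : nat)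
    (Q : {poly R}) :
  Q != 0 -> (size Q <= n)%N ->
  (forall j, (j <= n)%N -> moment_fun mu (Q * 'X^j) = 0) ->
  \det (hankel (fun i => mu i.+1) n) = 0.
Proof.
move=> Q0 sQ orthQ; apply/eqP/det0P; exists (\row_i Q`_i).
  apply: contraNneq Q0 => q0; apply/eqP/polyP=> i; rewrite coef0.
  have [lt_i|le_i] := ltnP i n; last by rewrite nth_default ?(leq_trans sQ).
  by have /rowP/(_ (Ordinal lt_i)) := q0; rewrite !mxE.
apply/rowP=> j; rewrite !mxE -[RHS](orthQ _ (ltn_ord j)) (moment_funMXn _ _ sQ).
by apply: eq_bigr => i _; rewrite !mxE addnS.
Qed.

(** * Determinants of block exchanges and of the antidiagonal matrix *)

(** The exchange is a product of three shears and a change of sign in k coordinates. *)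
Lemma det_swap_mx (R : comNzRingType) (k : nat) :
  \det (block_mx 0 1%:M 1%:M 0 : 'M[R]_(k + k)) = (-1) ^+ k.
Proof.
have : (block_mx 0 1%:M 1%:M 0 : 'M[R]_(k + k)) =
  block_mx 1%:M 1%:M 0 1%:M *m block_mx 1%:M 0 (- 1%:M) 1%:M
  *m block_mx 1%:M 1%:M 0 1%:M *m block_mx (- 1%:M) 0 0 1%:M.
  rewrite !mulmx_block !(mulmx1, mul1mx, mulmx0, mul0mx, addr0, add0r, mulmxN, mulNmx).
  by rewrite subrr oppr0 add0r opprK addNr.
move=> ->; rewrite !det_mulmx !det_ublock !det_lblock !det1 !mul1r mulr1.
by rewrite -scaleN1r detZ det1 mulr1.
Qed.

(** Once the last two block columns are exchanged, the matrix is a product of two block triangular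
    matrices, each of which contributes one factor [\det D]. *)
Lemma det_block_swap (R : comNzRingType) (n k : nat) (A : 'M[R]_n)
    (b : 'M_(n, k)) (c : 'M_(k, n)) (d D : 'M_k) :
  \det (block_mx A (row_mx b 0) (col_mx c 0) (block_mx d D D 0))
  = (-1) ^+ k * \det D ^+ 2 * \det A.
Proof.
pose swap : 'M[R]_(k + k) := block_mx 0 1%:M 1%:M 0.
pose U := block_mx 1%:M (row_mx 0 b) 0 (block_mx 1%:M d 0 D).
pose V : 'M_(n + (k + k)) := block_mx A 0 (col_mx c 0) (block_mx D 0 0 1%:M).
have ->: block_mx A (row_mx b 0) (col_mx c 0) (block_mx d D D 0)
  = U *m V *m block_mx 1%:M 0 0 swap.
  rewrite !mulmx_block !(mulmx1, mul1mx, mulmx0, mul0mx, addr0, add0r).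
  rewrite !mul_row_block mul_row_col mul_block_col mulmx_block.
  by rewrite !(mulmx1, mul1mx, mulmx0, mul0mx, addr0, add0r).
rewrite !det_mulmx det_ublock !det_lblock !det_ublock !det1 det_swap_mx.
by ring.
Qed.

Lemma det_antidiag (R : comNzRingType) (n : nat) :
  \det (\matrix_(i < n, j < n) ((i + j).+1 == n)%:R : 'M[R]_n) = (-1) ^+ 'C(n, 2).
Proof.
elim: n => [|n IH]; first by rewrite det_mx00.
rewrite (expand_det_row _ 0) (bigD1 ord_max) //= big1 ?addr0 => [|j]; last first.
  by rewrite -val_eqE mxE /= eqSS => /negbTE->; rewrite mul0r.
rewrite mxE /= eqxx mul1r /cofactor add0n binS bin1 addnC exprD.
rewrite -IH; congr (_ * \det _); apply/matrixP=> i j.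
by rewrite !mxE /= /bump (leqNgt n) ltn_ord /= !add1n addSn eqSS.
Qed.

(** * The polynomials T_m, E and O: product formulas, values at 0, degrees *)

Section Lucas.
Variables (R : comNzRingType) (x y : R).

(* t^m + t'^m, where ['X = x + y + t + t'] and t t' = x y *)
Fixpoint lucas (m : nat) : {poly R} :=
  if m is m1.+1 then
    if m1 is m2.+1 then
      ('X - (x + y)%:P) * lucas m1 - (x * y)%:P * lucas m2
    else 'X - (x + y)%:P
  else 2%:R.

(* (t - t') (t^m - t'^m) *)
Definition lucas_diff (m : nat) : {poly R} :=
  if m is m1.+1 then lucas m1.+2 - (x * y)%:P * lucas m1 else 0.

Lemma lucasSS (m : nat) :
  lucas m.+2 = ('X - (x + y)%:P) * lucas m.+1 - (x * y)%:P * lucas m.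
Proof. by []. Qed.

Lemma lucas_diffS (m : nat) :
  lucas_diff m.+1 = lucas m.+2 - (x * y)%:P * lucas m.
Proof. by []. Qed.

Lemma lucas_diffSS (m : nat) :
  lucas_diff m.+2 = ('X - (x + y)%:P) * lucas_diff m.+1 - (x * y)%:P * lucas_diff m.
Proof. by case: m => [|m]; rewrite /lucas_diff !lucasSS /=; ring. Qed.

(** A solution of the recurrence behaves like a combination of t^m and t'^m, and multiplying these
    by t^k + t'^k shifts the index by k both ways, with t t' = s. Both T_m and (t - t') (t^m - t'^m)
    are solutions. *)
Lemma mulr_lucas (W : nat -> {poly R}) :
  (forall m, W m.+2 = ('X - (x + y)%:P) * W m.+1 - (x * y)%:P * W m) ->
  forall k m, W (m + k)%N * lucas k = W (m + k.*2)%N + (x * y)%:P ^+ k * W m.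
Proof.
move=> WSS; elim/nat_ind2=> [m|m|k IH0 IH1 m].
- by rewrite !addn0 /=; ring.
- by rewrite addn1 addn2 WSS /=; ring.
have := IH0 m.+2; have := IH1 m.+1; rewrite !(addSn, addnS, doubleS) => E1 E0.
by rewrite lucasSS mulrBr !(mulrCA (W _)) E1 E0 !WSS !exprS; ring.
Qed.

Lemma lucasM (k m : nat) :
  lucas (m + k) * lucas k = lucas (m + k.*2) + (x * y)%:P ^+ k * lucas m.
Proof. exact: mulr_lucas. Qed.

Lemma lucas_diffM (k m : nat) :
  lucas_diff (m + k) * lucas k
  = lucas_diff (m + k.*2) + (x * y)%:P ^+ k * lucas_diff m.
Proof. exact: (mulr_lucas lucas_diffSS). Qed.

Lemma lucas_horner0 (m : nat) : (lucas m).[0] = (- x) ^+ m + (- y) ^+ m.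
Proof.
elim/nat_ind2: m => [||m IH0 IH1].
- by rewrite /= -[2%:R]polyC_natr hornerC.
- by rewrite /= !hornerE; ring.
- by rewrite lucasSS !hornerE IH0 IH1 !exprS; ring.
Qed.

Lemma lucas_diff_horner0 (m : nat) :
  (lucas_diff m).[0] = (y - x) * ((- x) ^+ m - (- y) ^+ m).
Proof.
case: m => [|m]; first by rewrite /= horner0 subrr mulr0.
by rewrite /lucas_diff hornerD hornerN hornerM hornerC !lucas_horner0 !exprS; ring.
Qed.

(* (t^K + t'^K) / (t^k + t'^k) with K = (2 p + 1) k *)
Fixpoint lucas_even (k p : nat) : {poly R} :=
  if p is p'.+1 then lucas (k * p.*2) - (x * y)%:P ^+ k * lucas_even k p' else 1.

(* (t - t') (t^K - t'^K) / (t^k + t'^k) with K = 2 p k *)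
Fixpoint lucas_odd (k p : nat) : {poly R} :=
  if p is p'.+1 then
    lucas_diff (k * p'.*2.+1) - (x * y)%:P ^+ k * lucas_odd k p'
  else 0.

Lemma lucas_oddS (k p : nat) :
  lucas_odd k p.+1 = lucas_diff (k * p.*2.+1) - (x * y)%:P ^+ k * lucas_odd k p.
Proof. by []. Qed.

(** For p > 0, the product of T_(2pk) and T_k is T_((2p+1)k) + s^k T_((2p-1)k); the recursive term
    of [lucas_even] removes the second summand. *)
Lemma lucas_evenM (k p : nat) : lucas_even k p * lucas k = lucas (k * p.*2.+1).
Proof.
elim: p => [|p IH]; first by rewrite mul1r muln1.
rewrite /= mulrBl -mulrA IH doubleS.
have -> : (k * p.*2.+2 = k * p.*2.+1 + k)%N by rewrite mulnSr.
rewrite lucasM addrK; congr lucas; lia.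
Qed.

Lemma lucas_oddM (k p : nat) : lucas_odd k p * lucas k = lucas_diff (k * p.*2).
Proof.
elim: p => [|p IH]; first by rewrite mul0r muln0.
rewrite /= mulrBl -mulrA IH doubleS.
have -> : (k * p.*2.+1 = k * p.*2 + k)%N by rewrite mulnSr.
rewrite lucas_diffM addrK; congr lucas_diff; lia.
Qed.

(** A size bound with one coefficient is easy to propagate through sums; [monic_degP] recovers the
    usual notion because 1 is not 0. *)
Definition monic_deg (p : {poly R}) (n : nat) : Prop :=
  (size p <= n.+1)%N /\ p`_n = 1.

Lemma monic_degP (p : {poly R}) (n : nat) :
  monic_deg p n -> p \is monic /\ size p = n.+1.
Proof.
move=> [sp pn]; have szp : size p = n.+1.
  apply/eqP; rewrite eqn_leq sp ltnNge; apply/negP => le_n.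
  by move/eqP: pn; rewrite nth_default // eq_sym oner_eq0.
by rewrite monicE lead_coefE szp pn.
Qed.

Lemma monic_degD (p q : {poly R}) (n : nat) :
  monic_deg p n -> (size q <= n)%N -> monic_deg (p + q) n.
Proof.
move=> [sp pn] sq; split; last by rewrite coefD pn nth_default ?addr0.
by rewrite (leq_trans (size_polyD _ _)) // geq_max sp leqW.
Qed.

Lemma monic_degXsubCM (c : R) (p : {poly R}) (n : nat) :
  monic_deg p n -> monic_deg (('X - c%:P) * p) n.+1.
Proof.
move=> [sp pn]; split; last first.
  by rewrite mulrBl coefB coefXM coefCM pn [p`__]nth_default // mulr0 subr0.
by rewrite (leq_trans (size_polyMleq _ _)) // size_XsubC.
Qed.

Lemma size_opp_polyCM (c : R) (p : {poly R}) : (size (- (c%:P * p)) <= size p)%N.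
Proof. by rewrite size_polyN mul_polyC size_scale_leq. Qed.

(** Kept apart from [monic_lucas] so as to include T_0 = 2, which is not monic. *)
Lemma size_lucas (m : nat) : (size (lucas m) <= m.+1)%N.
Proof.
elim/nat_ind2: m => [||m IH0 IH1].
- by rewrite /= -polyC_natr size_polyC_leq1.
- by rewrite /= size_XsubC.
- rewrite lucasSS (leq_trans (size_polyD _ _)) // geq_max.
  rewrite (leq_trans (size_polyMleq _ _)) ?size_XsubC //=.
  apply: leq_trans (size_opp_polyCM _ _) (leq_trans IH0 _); exact: leqW (leqnSn _).
Qed.

Lemma monic_lucas (m : nat) : (0 < m)%N -> monic_deg (lucas m) m.
Proof.
case: m => // m _; elim: m => [|m IH].
  by split; rewrite /= ?size_XsubC // coefB coefX coefC subr0.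
rewrite lucasSS; apply: monic_degD; first exact: monic_degXsubCM.
exact: leq_trans (size_opp_polyCM _ _) (leqW (size_lucas _)).
Qed.

Lemma monic_lucas_diff (m : nat) : (0 < m)%N -> monic_deg (lucas_diff m) m.+1.
Proof.
case: m => // m _; apply: monic_degD; first exact: monic_lucas.
exact: leq_trans (size_opp_polyCM _ _) (leqW (size_lucas _)).
Qed.

Lemma monic_lucas_even (k p : nat) :
  (0 < k)%N -> monic_deg (lucas_even k p) (k * p.*2).
Proof.
move=> k0; elim: p => [|p [IH _]].
  by rewrite muln0; split; rewrite /= ?size_poly1 ?coef1.
apply: monic_degD; first by apply: monic_lucas; rewrite muln_gt0 k0.
rewrite -polyC_exp (leq_trans (size_opp_polyCM _ _)) // (leq_trans IH) //.
by rewrite ltn_pmul2l // doubleS.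
Qed.

Lemma monic_lucas_odd (k p : nat) :
  (0 < k)%N -> monic_deg (lucas_odd k p.+1) (k * p.*2.+1).+1.
Proof.
move=> k0; elim: p => [|p [IH _]].
  rewrite /= mulr0 subr0; by apply: monic_lucas_diff; rewrite muln1.
rewrite lucas_oddS; apply: monic_degD.
  by apply: monic_lucas_diff; rewrite muln_gt0 k0.
rewrite -polyC_exp; apply: leq_trans (size_opp_polyCM _ _) (leq_trans IH _).
by rewrite doubleS; nia.
Qed.

End Lucas.

(** * The functionals L_d and the unshifted Hankel determinants *)

Section PathMoments.
Variables (R : comNzRingType) (x y : R) (mu : nat -> int -> R).
Hypothesis mu0 : forall d, mu 0 d = (d == 0)%:R.
Hypothesis muS : forall n d,
  mu n.+1 d = mu n (d - 1) + (x + y) * mu n d + x * y * mu n (d + 1).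

Local Notation L d := (moment_fun (mu ^~ d)).
Local Notation lucas := (lucas x y).
Local Notation lucas_diff := (lucas_diff x y).
Local Notation lucas_even := (lucas_even x y).
Local Notation lucas_odd := (lucas_odd x y).

Lemma path_moment_out (n : nat) (d : int) : (n < `|d|)%N -> mu n d = 0.
Proof.
elim: n d => [|n IH] d lt_nd; first by rewrite mu0 -absz_eq0 gtn_eqF.
by rewrite muS !IH ?mulr0 ?addr0 //; lia.
Qed.

Lemma path_moment_diag (n : nat) : mu n n = 1.
Proof.
elim: n => [|n IH]; first by rewrite mu0.
rewrite muS (_ : n.+1%:Z - 1 = n) ?IH; last by lia.
by rewrite !path_moment_out ?mulr0 ?addr0 //; lia.
Qed.

(** Reflection in the axis exchanges rises of weight 1 with falls of weight s, and a path from
    height 0 to height d has d more rises than falls. *)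
Lemma path_moment_sym (n d : nat) : (x * y) ^+ d * mu n d = mu n (- d%:Z).
Proof.
elim: n d => [|n IH] d.
  rewrite !mu0 oppr_eq0; case: d => [|d]; first by rewrite mul1r.
  by rewrite mulr0.
rewrite !muS; case: d => [|d]; first by rewrite expr0 mul1r.
rewrite (_ : d.+1%:Z - 1 = d) 1?(_ : d.+1%:Z + 1 = d.+2); try lia.
rewrite (_ : - d.+1%:Z - 1 = - d.+2%:Z) 1?(_ : - d.+1%:Z + 1 = - d%:Z); try lia.
by rewrite -!IH !exprS; ring.
Qed.

Lemma moment_path_mulX (d : int) (p : {poly R}) :
  L d ('X * p) = L (d - 1) p + (x + y) * L d p + x * y * L (d + 1) p.
Proof.
rewrite mulrC (@moment_funMXn _ _ 1 _ _ (leqnn (size p))) /moment_fun.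
rewrite !mulr_sumr -!big_split; apply: eq_bigr => i _ /=.
by rewrite addn1 muS; ring.
Qed.

(** Taking the coefficient of t^d after multiplication by t^m reads the coefficient of t^(d-m); for
    t'^m = s^m t^(-m) it reads s^m times that of t^(d+m). *)
Lemma moment_path_lucasM (m : nat) (d : int) (p : {poly R}) :
  L d (lucas m * p) = L (d - m%:Z) p + (x * y) ^+ m * L (d + m%:Z) p.
Proof.
elim/nat_ind2: m d => [d|d|m IH0 IH1 d].
- by rewrite (_ : d - 0%:Z = d) 1?(_ : d + 0%:Z = d) ?mul1r
     ?mulr_natl ?raddfMn ?mulr2n; try lia.
- by rewrite /= mulrBl raddfB /= moment_path_mulX mul_polyC linearZ /=; ring.
rewrite (exprD _ 2 m) lucasSS mulrBl -!mulrA mulrBl raddfB raddfB /=.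
rewrite moment_path_mulX !mul_polyC.
rewrite !linearZ /= !IH0 !IH1.
rewrite (_ : d - 1 - m.+1%:Z = d - m.+2%:Z); last by lia.
rewrite (_ : d - 1 + m.+1%:Z = d + m%:Z); last by lia.
rewrite (_ : d + 1 - m.+1%:Z = d - m%:Z); last by lia.
rewrite (_ : d + 1 + m.+1%:Z = d + m.+2%:Z); last by lia.
by rewrite exprS; ring.
Qed.

Lemma moment_path_sym (d : nat) (p : {poly R}) :
  (x * y) ^+ d * L d p = L (- d%:Z) p.
Proof.
by rewrite /moment_fun mulr_sumr; apply: eq_bigr => i _; rewrite mulrCA path_moment_sym.
Qed.

(** At d = 0 the two terms of [moment_path_lucasM] coincide by reflection. This is the bridge
    between L_m and L_0. *)
Lemma moment_path_lucas0 (m : nat) (p : {poly R}) :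
  L 0 (lucas m * p) = 2%:R * (x * y) ^+ m * L m p.
Proof. by rewrite moment_path_lucasM sub0r add0r -moment_path_sym; ring. Qed.

(** T_0 = 2 is replaced by 1 to obtain a monic basis. *)
Definition lucas_basis (i : nat) : {poly R} := if i is 0 then 1 else lucas i.

Lemma lucas_basisS (i : nat) : lucas_basis i.+1 = lucas i.+1.
Proof. by []. Qed.

Lemma lucas_basis_monic (i : nat) :
  lucas_basis i \is monic /\ size (lucas_basis i) = i.+1.
Proof.
by case: i => [|i]; [rewrite monic1 size_poly1 | apply: monic_degP; exact: monic_lucas].
Qed.

Lemma det_hankel_lucas (k : int) (n : nat) :
  \det (hankel (mu ^~ k) n)
  = \det (\matrix_(i < n, j < n) L k (lucas_basis i * lucas_basis j)).
Proof. by apply: det_hankel_basis => i; case: (lucas_basis_monic i). Qed.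

Lemma moment_path_basis (d : int) (j : nat) :
  L d (lucas_basis j) = (d == j)%:R +
    (if j is 0 then 0 else (x * y) ^+ j *+ (d == - j%:Z)).
Proof.
case: j => [|j]; first by rewrite moment_fun1 mu0 addr0.
rewrite /lucas_basis -[lucas _]mulr1 moment_path_lucasM !moment_fun1 !mu0.
by rewrite subr_eq0 addr_eq0 mulr_natr.
Qed.

(** For i > 0 the value is L_(k-i)(T_j) + s^i L_(k+i)(T_j), and L_d(T_j) vanishes unless d is j or
    -j. *)
Lemma moment_path_basisM (k i j : nat) : (0 < k)%N -> (i <= j)%N ->
  L k (lucas_basis i * lucas_basis j)
  = if (i == 0)%N then (j == k)%:R
    else (i + j == k)%:R + (x * y) ^+ i *+ (j == i + k)%N.
Proof.
move=> k0 le_ij; case: i le_ij => [|i] le_ij.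
  rewrite mul1r moment_path_basis; case: j {le_ij} => [|j].
    by rewrite addr0 eqz_nat eq_sym.
  by rewrite (_ : (k%:Z == - j.+1%:Z) = false) ?addr0 1?eq_sym //; lia.
rewrite moment_path_lucasM !moment_path_basis; case: j le_ij => // j le_ij.
rewrite (_ : (k%:Z - i.+1%:Z == j.+1) = (i.+1 + j.+1 == k)%N); last by lia.
rewrite (_ : (k%:Z - i.+1%:Z == - j.+1%:Z) = (i.+1 == j.+1 + k)%N); last by lia.
rewrite (_ : (k%:Z + i.+1%:Z == j.+1) = (j.+1 == i.+1 + k)%N); last by lia.
rewrite (_ : (k%:Z + i.+1%:Z == - j.+1%:Z) = false); last by lia.
rewrite (_ : (i.+1 == j.+1 + k)%N = false); last by lia.
by rewrite addr0 addr0 mulr_natr.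
Qed.

Lemma det_hankel_path0 (n : nat) :
  \det (hankel (mu ^~ 0) n.+1) = 2%:R ^+ n * (x * y) ^+ 'C(n.+1, 2).
Proof.
rewrite det_hankel_lucas.
have -> : \matrix_(i < n.+1, j < n.+1) L 0 (lucas_basis i * lucas_basis j)
  = diag_mx (\row_(i < n.+1) (if (i == 0 :> nat) then 1 else 2%:R * (x * y) ^+ i)).
  apply/matrixP=> -[i lt_i] [j lt_j]; rewrite !mxE -val_eqE /= {lt_i lt_j}.
  case: i => [|i].
    rewrite mul1r moment_path_basis.
    by case: j => [|j]; rewrite ?addr0 ?mulr0n ?addr0.
  rewrite lucas_basisS moment_path_lucas0 moment_path_basis eqz_nat.
  case: j => [|j]; first by rewrite addr0 mulr_natr.
  by rewrite (_ : (i.+1%:Z == - j.+1%:Z) = false) ?addr0 ?mulr_natr.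
rewrite det_diag big_ord_recl mxE /= mul1r.
under eq_bigr => i _ do rewrite mxE /= /bump leq0n add1n.
rewrite big_split /= prodr_const card_ord; congr (_ * _).
by rewrite prodrXr -bin2_sum big_mkord big_ord_recl.
Qed.

(** In the basis T_m each of the last k rows and columns has a single nonzero entry, which lies in
    the block of k indices before them. So [det_block_swap] splits off the last 2k indices. *)
Lemma det_hankel_path_step (k n : nat) : (0 < k)%N ->
  \det (hankel (mu ^~ k%:Z) (n + (k + k)))
  = (-1) ^+ k * (x * y) ^+ (k * n.*2 + k * k.-1) * \det (hankel (mu ^~ k%:Z) n).
Proof.
move=> k0; rewrite !det_hankel_lucas.
pose B :=
  \matrix_(i < n + (k + k), j < n + (k + k)) L k (lucas_basis i * lucas_basis j).
pose D : 'M[R]_k := diag_mx (\row_i (x * y) ^+ (n + i)).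
(* The column index is c = n + k + j. The condition i + c = k can hold only for i = 0, where the
   entry is 1 = s^0; c = i + k means i = n + j; and i = c + k is out of range. *)
have BE : forall (i : 'I_(n + (k + k))) (j : 'I_k), 
    B i (rshift n (rshift k j)) = (x * y) ^+ i *+ (i == (n + j)%N :> nat).
  move=> i j; have lt_i := ltn_ord i; have lt_j := ltn_ord j.
  have [le_ij|lt_ji] := leqP i (n + (k + j)).
    rewrite mxE moment_path_basisM //=; case: eqP => [i0|i0].
      by rewrite i0 expr0; congr (_ *+ _); lia.
    rewrite (_ : (_ == k)%N = false) ?add0r; last by lia.
    by congr (_ *+ _); lia.
  rewrite mxE mulrC moment_path_basisM //=; last by lia.
  rewrite (_ : (n + (k + j) == 0)%N = false); last by lia.
  rewrite (_ : (n + (k + j) + i == k)%N = false); last by lia.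
  rewrite (_ : (i == (n + (k + j) + k)%N :> nat) = false); last by lia.
  by rewrite (_ : (i == (n + j)%N :> nat) = false) ?addr0 //; lia.
have Bsym : B^T = B by apply/matrixP=> i j; rewrite !mxE mulrC.
have BE' (i : 'I_k) (j : 'I_(n + (k + k))) :
    B (rshift n (rshift k i)) j = (x * y) ^+ j *+ (j == (n + i)%N :> nat).
  by rewrite -[B]Bsym mxE BE.
rewrite -[X in \det X = _]/B.
have -> : B = block_mx (ulsubmx B) (row_mx (lsubmx (ursubmx B)) 0)
  (col_mx (usubmx (dlsubmx B)) 0) (block_mx (ulsubmx (drsubmx B)) D D 0).
  rewrite -{1}[B]submxK; congr block_mx.
  - rewrite -{1}[ursubmx B]hsubmxK; congr row_mx; apply/matrixP=> i j.
    by do 3![rewrite [LHS]mxE]; rewrite BE mxE /= ltn_eqF ?ltn_addr.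
  - rewrite -{1}[dlsubmx B]vsubmxK; congr col_mx; apply/matrixP=> i j.
    by do 3![rewrite [LHS]mxE]; rewrite BE' mxE /= ltn_eqF ?ltn_addr.
  - rewrite -{1}[drsubmx B]submxK; congr block_mx; apply/matrixP=> i j.
    + do 4![rewrite [LHS]mxE]; rewrite BE !mxE eqn_add2l -val_eqE /=.
      by case: eqP => // ->.
    + do 4![rewrite [LHS]mxE]; rewrite BE' !mxE eqn_add2l -val_eqE eq_sym /=.
      by case: eqP => // ->.
    + do 4![rewrite [LHS]mxE]; rewrite BE mxE eqn_add2l gtn_eqF //.
      rewrite (leq_trans (ltn_ord j)) //.
      exact: leq_addr.
have -> : ulsubmx B = \matrix_(i, j) L k (lucas_basis i * lucas_basis j).
  by apply/matrixP=> i j; rewrite !mxE.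
rewrite det_block_swap det_diag; congr (_ * _ * _).
under eq_bigr => i _ do rewrite mxE.
rewrite prodrXr big_split sum_nat_const card_ord -exprM; congr (_ ^+ _) => /=.
rewrite mulnDl -muln2 mulnA; congr (_ + _)%N.
have -> : (\sum_(i < k) i = 'C(k, 2))%N by rewrite -bin2_sum big_mkord.
by rewrite mulnC -mul_bin_diag bin1.
Qed.

(** At this size the indices are at most k, so j = i + k is impossible for i > 0 and only the
    antidiagonal i + j = k survives. *)
Lemma det_hankel_path_base (k : nat) : (0 < k)%N ->
  \det (hankel (mu ^~ k%:Z) k.+1) = (-1) ^+ 'C(k.+1, 2).
Proof.
move=> k0; rewrite det_hankel_lucas -det_antidiag; congr (\det _).
apply/matrixP=> i j; rewrite !mxE eqSS.
have lt_i := ltn_ord i; have lt_j := ltn_ord j.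
wlog le_ij : i j lt_i lt_j / (i <= j)%N => [IH|].
  case: (leqP i j) => [|/ltnW] le_ij; first exact: IH.
  by rewrite mulrC addnC IH.
rewrite moment_path_basisM //; case: eqP => [->|i0]; first by rewrite add0n.
by rewrite (_ : (j == i + k :> nat)%N = false) ?addr0 //; lia.
Qed.

Lemma det_hankel_path_iter (k n p : nat) : (0 < k)%N ->
  \det (hankel (mu ^~ k%:Z) (k * p.*2 + n))
  = (-1) ^+ (k * p) * (x * y) ^+ (k * p * (k * p.*2 + n.*2 - k.+1))
    * \det (hankel (mu ^~ k%:Z) n).
Proof.
move=> k0; elim: p => [|p IH]; first by rewrite !muln0 !mul1r.
have -> : (k * p.+1.*2 + n = k * p.*2 + n + (k + k))%N by lia.
rewrite det_hankel_path_step // IH [LHS]mulrA mulrACA -!exprD.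
congr (_ ^+ _ * _ ^+ _ * _).
  by lia.
case: k k0 {IH} => // k _.
(* The subtraction in the exponent is a true one after at least one step; at p = 0 it is multiplied
   by 0. *)
have eS q : (k.+1 * q.+1.*2 + n.*2 - k.+2 = k.+1 * q.*2 + k + n.*2)%N by lia.
by case: p => [|p]; rewrite !eS; lia.
Qed.


End PathMoments.

(** * Orthogonality of E and O, and the shifted determinants *)

Section ShiftedHankel.
Variables (R : idomainType) (x y : R) (mu : nat -> int -> R).
Hypothesis mu0 : forall d, mu 0 d = (d == 0)%:R.
Hypothesis muS : forall n d,
  mu n.+1 d = mu n (d - 1) + (x + y) * mu n d + x * y * mu n (d + 1).
Hypothesis nz2 : 2%:R != 0 :> R.
Hypothesis nzxy : x * y != 0.

Local Notation L d := (moment_fun (mu ^~ d)).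
Local Notation lucas := (lucas x y).
Local Notation lucas_diff := (lucas_diff x y).
Local Notation lucas_even := (lucas_even x y).
Local Notation lucas_odd := (lucas_odd x y).
Local Notation H k := (hankel (mu ^~ k)).
Local Notation D k n := (\det (hankel (fun i => mu i.+1 k) n)).

(** Passing from L_m to L_0 introduces this factor, which is cancelled afterwards. *)
Let nz2xy (m : nat) : 2%:R * (x * y) ^+ m != 0.
Proof. by rewrite mulf_neq0 ?expf_neq0. Qed.

(** With K = (2p+1)k: 2 s^k L_k(E q) = L_0(T_k E q) = L_0(T_K q) = 2 s^K L_K(q). *)
Lemma moment_lucas_even (k p : nat) (q : {poly R}) :
  L k (lucas_even k p * q) = (x * y) ^+ (k * p.*2) * L (k * p.*2.+1)%N q.
Proof.
apply: (mulfI (nz2xy k)); rewrite -(moment_path_lucas0 mu0 muS).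
rewrite mulrA [lucas k * _]mulrC lucas_evenM (moment_path_lucas0 mu0 muS).
by rewrite mulrA -[_ * _ ^+ k * _]mulrA -exprD mulnSr [(k + _)%N]addnC.
Qed.

(** With K = 2(p+1)k: T_k O = T_(K+1) - s T_(K-1), and L_0 sends the product with q to 2 s^K (s
    L_(K+1)(q) - L_(K-1)(q)). *)
Lemma moment_lucas_odd (k p : nat) (q : {poly R}) : (0 < k)%N ->
  L k (lucas_odd k p.+1 * q)
  = (x * y) ^+ (k * p.*2.+1)
    * (x * y * L (k * p.+1.*2).+1 q - L (k * p.+1.*2).-1 q).
Proof.
move=> k0; apply: (mulfI (nz2xy k)); rewrite -(moment_path_lucas0 mu0 muS).
rewrite mulrA [lucas k * _]mulrC lucas_oddM.
have K0 : (0 < k * p.+1.*2)%N by rewrite muln_gt0 k0.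
have -> : (k * p.*2.+1 = (k * p.+1.*2).-1.+1 - k)%N by lia.
rewrite -[in lucas_diff _](prednK K0) lucas_diffS mulrBl mul_polyC -scalerAl.
set T := lucas _.+2; rewrite raddfB /= linearZ /= {}/T !(moment_path_lucas0 mu0 muS).
have leK : (k <= (k * p.+1.*2).-1.+1)%N by lia.
rewrite [RHS]mulrA -[2%:R * _ ^+ k * _]mulrA -exprD subnKC // (prednK K0).
by case: (k * _)%N K0 => // m _; rewrite !exprS /=; ring.
Qed.

(** The size equals the degree of E, which is below the first nonorthogonal power X^((2p+1)k). *)
Lemma shifted_even_diag (k p : nat) : (0 < k)%N ->
  D k (k * p.*2) = (-1) ^+ (k * p.*2) * (lucas_even k p).[0] * \det (H k (k * p.*2)).
Proof.
move=> k0; have [sE cE] := monic_lucas_even x y p k0.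
rewrite horner_coef0 -(det_hankel_shift_lead sE) ?cE ?mul1r // => j lt_j.
by rewrite moment_lucas_even moment_funXn (path_moment_out mu0 muS) ?mulr0 //; lia.
Qed.

(** The size is the exponent of the first power not orthogonal to E, whose moment comes from the
    single path made of rises. *)
Lemma shifted_even_next (k p : nat) : (0 < k)%N ->
  (x * y) ^+ (k * p.*2) * D k (k * p.*2.+1)
  = (-1) ^+ (k * p.*2.+1) * (lucas_even k p).[0] * \det (H k (k * p.*2.+1).+1).
Proof.
move=> k0; have [sE cE] := monic_lucas_even x y p k0.
rewrite horner_coef0 -det_hankel_shift_last.
- by rewrite moment_lucas_even moment_funXn (path_moment_diag mu0 muS) mulr1.
- by rewrite (leq_trans sE) // ltnS leq_pmul2l.
move=> j lt_j.
by rewrite moment_lucas_even moment_funXn (path_moment_out mu0 muS) ?mulr0 //; lia.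
Qed.

(** The degree of O is K - k + 1 with K = 2(p+1)k, and O is orthogonal to X^j for j < K - 1; these
    fit together because k > 1. *)
Lemma shifted_odd_diag (k p : nat) : (1 < k)%N ->
  D k (k * p.*2.+1).+1
  = (-1) ^+ (k * p.*2.+1).+1 * (lucas_odd k p.+1).[0] * \det (H k (k * p.*2.+1).+1).
Proof.
move=> k1; have k0 := ltnW k1; have [sO cO] := monic_lucas_odd x y p k0.
rewrite horner_coef0 -(det_hankel_shift_lead sO) ?cO ?mul1r // => j lt_j.
rewrite moment_lucas_odd // !moment_funXn.
by rewrite !(path_moment_out mu0 muS) ?mulr0 ?subr0 ?mulr0 //; lia.
Qed.

Lemma shifted_odd_next (k p : nat) : (1 < k)%N ->
  - (x * y) ^+ (k * p.*2.+1) * D k (k * p.+1.*2).-1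
  = (-1) ^+ (k * p.+1.*2).-1 * (lucas_odd k p.+1).[0] * \det (H k (k * p.+1.*2)).
Proof.
move=> k1; have k0 := ltnW k1; have [sO cO] := monic_lucas_odd x y p k0.
have K0 : (0 < k * p.+1.*2)%N by rewrite muln_gt0 k0.
rewrite horner_coef0 -[in \det (H _ _)](prednK K0) -det_hankel_shift_last.
- rewrite moment_lucas_odd // !moment_funXn (path_moment_diag mu0 muS).
  by rewrite (path_moment_out mu0 muS) ?mulr0 ?sub0r ?mulrN1 //; lia.
- by rewrite (leq_trans sO) //; lia.
move=> j lt_j; rewrite moment_lucas_odd // !moment_funXn.
by rewrite !(path_moment_out mu0 muS) ?mulr0 ?subr0 ?mulr0 //; lia.
Qed.

Lemma shifted_eq0 (k n : nat) : (0 < k)%N ->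
  (n %% (2 * k))%N \notin [:: 0; k; k + 1; 2 * k - 1]%N -> D k n = 0.
Proof.
move=> k0; rewrite !inE !negb_or; set r := (n %% _)%N => /and4P[r0 rk rk1 r2k].
have := divn_eq n (2 * k); rewrite -/r; set p := (n %/ _)%N => En.
have lt_r : (r < 2 * k)%N by rewrite ltn_mod muln_gt0 k0.
(* For 0 < r < k the witness is E, of degree 2pk < n < (2p+1)k; for k + 1 < r < 2k - 1 it is O, of
   degree (2p+1)k + 1 < n < 2(p+1)k - 1. *)
have [lt_rk|le_kr] := ltnP r k.
  have [sE cE] := monic_lucas_even x y p k0.
  apply: (@det_hankel_shift_eq0 _ (mu ^~ k%:Z) _ (lucas_even k p)).
  - by apply/eqP=> q0; move/eqP: cE; rewrite q0 coef0 eq_sym oner_eq0.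
  - by rewrite (leq_trans sE) // En; lia.
  move=> j le_j; rewrite moment_lucas_even moment_funXn.
  by rewrite (path_moment_out mu0 muS) ?mulr0 //; lia.
have [sO cO] := monic_lucas_odd x y p k0.
apply: (@det_hankel_shift_eq0 _ (mu ^~ k%:Z) _ (lucas_odd k p.+1)).
- by apply/eqP=> q0; move/eqP: cO; rewrite q0 coef0 eq_sym oner_eq0.
- by rewrite (leq_trans sO) // En; lia.
move=> j le_j; rewrite moment_lucas_odd // !moment_funXn.
by rewrite !(path_moment_out mu0 muS) ?mulr0 ?subr0 ?mulr0 //; lia.
Qed.

(** For k = 0 the polynomial T_n itself is orthogonal to all lower powers. *)
Lemma shifted_zero (n : nat) : (0 < n)%N ->
  D 0 n = 2%:R ^+ n.-1 * (x * y) ^+ 'C(n, 2) * (x ^+ n + y ^+ n).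
Proof.
case: n => // n _; have [sT cT] := monic_lucas x y (ltn0Sn n).
have := @det_hankel_shift_lead _ (mu ^~ 0) _ _ sT; rewrite cT mul1r => ->.
  rewrite (det_hankel_path0 mu0 muS) -horner_coef0 lucas_horner0 mulrDr.
  by rewrite -!exprMn !mulrN !mulNr !mul1r !opprK mulrC.
move=> j lt_j; rewrite (moment_path_lucas0 mu0 muS) moment_funXn.
by rewrite (path_moment_out mu0 muS) ?mulr0 //; lia.
Qed.

(** The signs of T_k and T_K at t = -x, t' = -y agree, K being an odd multiple of k. *)
Lemma lucas_even_horner0 (k p : nat) :
  (lucas_even k p).[0] * (x ^+ k + y ^+ k) = x ^+ (k * p.*2 + k) + y ^+ (k * p.*2 + k).
Proof.
apply: (@lreg_sign R k).
have /(congr1 (fun q => q.[0])) := lucas_evenM x y k p.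
rewrite hornerM !lucas_horner0 !(exprNn x) !(exprNn y) -!mulrDr mulrCA => ->.
rewrite mulnSr; congr (_ * _).
by rewrite exprD -[in LHS]signr_odd oddM odd_double andbF mul1r.
Qed.

(** The sign comes from T_k at X = 0 and from t - t' = y - x. *)
Lemma lucas_odd_horner0 (k p : nat) :
  (-1) ^+ k.+1 * (lucas_odd k p).[0] * (x ^+ k + y ^+ k)
  = (x ^+ (k * p.*2) - y ^+ (k * p.*2)) * (x - y).
Proof.
have /(congr1 (fun q => q.[0])) := lucas_oddM x y k p.
rewrite hornerM lucas_horner0 lucas_diff_horner0 !(exprNn x) !(exprNn y).
have -> : (-1) ^+ (k * p.*2) = 1 :> R by rewrite -signr_odd oddM odd_double andbF.
by rewrite !mul1r => E; rewrite -(opprB y x) mulrN [_ * (y - x)]mulrC -E exprS; ring.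
Qed.

End ShiftedHankel.

(** * The recurrence for the path sums *)

Lemma path_gf0 (d : int) : path_gf 0 0 d = (d == 0)%:R.
Proof.
have E (p : 0.-tuple (seq_sub steps)) : path_from_to (0, 0) (0, d) p = (d == 0).
  by rewrite tuple0 /path_from_to big_nil addr0 xpair_eqE eqxx eq_sym.
rewrite /path_gf (eq_bigl _ _ E); have [d0|d0] := eqVneq d 0; last by rewrite big_pred0.
rewrite (big_pred1 [tuple]) /path_weight ?big_nil // => p.
by apply/esym/eqP; exact: tuple0.
Qed.

Lemma sum_steps (V : nmodType) (F : int * int -> V) :
  \sum_(s : seq_sub steps) F (val s) = F (1, 0) + F (1, 1) + F (1, -1).
Proof.
have E : [seq val s | s <- enum {: seq_sub steps}] = steps.
  by rewrite enumT unlock val_seq_sub_enum.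
by rewrite -big_enum -(big_map val xpredT) E !big_cons big_nil /= addr0 addrA.
Qed.

(** The first step is removed, and the rest is translated back to the origin. *)
Lemma path_gfS (n : nat) (d : int) :
  path_gf n.+1 0 d = path_gf n 0 (d - 1) + ('X + 'Y) * path_gf n 0 d
                     + 'X * 'Y * path_gf n 0 (d + 1).
Proof.
have -> : path_gf n.+1 0 d = \sum_(s : seq_sub steps)
    step_weight (val s) * path_gf n 0 (d - (val s).2).
  rewrite /path_gf; under [RHS]eq_bigr do rewrite mulr_sumr.
  rewrite pair_big_dep /=.
  rewrite (reindex (fun u : _ * n.-tuple (seq_sub steps) => cons_tuple u.1 u.2)) /=;
    last first.
    exists (fun p => (thead p, behead_tuple p)) => [[s p] _|p _] /=; last first.
      by rewrite [RHS]tuple_eta.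
    by congr (_, _); apply: val_inj.
  apply: eq_big => [[s p]|[s p] _]; last by rewrite /path_weight big_cons.
  (* Since every step advances by 1, only the condition on heights remains. *)
  have c1 : (ssval s).1 = 1.
    by case: s => [[c e]] /=; rewrite !inE => /or3P[] /eqP[-> _].
  rewrite /path_from_to big_cons; move: (\sum_(_ <- _) _) => [a b] /=.
  by case: (ssval s) c1 => [c e] /= ->; rewrite !xpair_eqE /=; congr (_ && _); lia.
rewrite (sum_steps (fun s => step_weight s * path_gf n 0 (d - s.2))) /step_weight /=.
by rewrite !mul1r subr0 opprK [_ * _ + _]addrC.
Qed.

Lemma nz2_ZXY : 2%:R != 0 :> ZXY.
Proof. by rewrite -!polyC_natr !polyC_eq0. Qed.

Lemma nzXY : 'X * 'Y != 0 :> ZXY.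
Proof. by rewrite mulf_neq0 ?polyC_eq0 ?polyX_eq0. Qed.

(** * Closed forms over Z[x, y] *)

Section ShiftedPaths.
Local Notation E k p := (lucas_even ('X : ZXY) ('Y : ZXY) k p).
Local Notation O k p := (lucas_odd ('X : ZXY) ('Y : ZXY) k p).
Local Notation D k n := (\det (hankel (fun i => path_gf i.+1 0 k%:Z) n)).

Lemma lucas_even_Pmk (k p : nat) : (0 < k)%N -> (E k p).[0] = Pmk (k * p.*2) k.
Proof.
move=> k0; apply: (mulIf (monic_neq0 (XkYk_monic k0))).
rewrite lucas_even_horner0 Pmk_mulK // dvdn_mulr // mulKn //.
by rewrite -signr_odd odd_double mul1r.
Qed.

(** For m = (2p+1)k + 1 and k > 1 the quotient is odd and the remainder is 1, so the second factor
    of the numerator is x - y. *)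
Lemma lucas_odd_Pmk (k p : nat) : (1 < k)%N ->
  (O k p.+1).[0] = (-1) ^+ k.+1 * Pmk (k * p.*2.+1).+1 k.
Proof.
move=> k1; have k0 := ltnW k1; apply: (@lreg_sign _ k.+1); rewrite signrMK.
apply: (mulIf (monic_neq0 (XkYk_monic k0))); rewrite lucas_odd_horner0.
have q : ((k * p.*2.+1).+1 %/ k = p.*2.+1)%N.
  by rewrite -addn1 mulnC divnMDl // divn_small ?addn0.
rewrite Pmk_mulK // q -(addn1 (k * _)) dvdn_addr ?dvdn_mulr // dvdn1 gtn_eqF //.
rewrite addKn -mulnSr -signr_odd /= odd_double !mulN1r.
by rewrite -doubleS.
Qed.

Lemma det_unshifted (k p : nat) : (0 < k)%N ->
  \det (hankel (fun i => path_gf i 0 k%:Z) (k * p.*2))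
  = (-1) ^+ (k * p) * ('X * 'Y) ^+ (k * p * (k * p.*2 - k.+1)).
Proof.
move=> k0; have := det_hankel_path_iter path_gf0 path_gfS 0 p k0.
by rewrite !addn0 det_mx00 mulr1.
Qed.

Lemma det_unshifted_next (k p : nat) : (0 < k)%N ->
  \det (hankel (fun i => path_gf i 0 k%:Z) (k * p.*2.+1).+1)
  = (-1) ^+ (k * p + 'C(k.+1, 2)) * ('X * 'Y) ^+ (k * p * (k * p.*2.+1 + 1)).
Proof.
move=> k0; have := det_hankel_path_iter path_gf0 path_gfS k.+1 p k0.
rewrite (det_hankel_path_base path_gf0 path_gfS) // mulrAC -exprD.
rewrite (_ : (k * p.*2 + k.+1 = (k * p.*2.+1).+1)%N) => [->|]; last by lia.
by congr (_ * _ ^+ (_ * _)); lia.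
Qed.

Lemma det_even_diag (k p : nat) : (0 < k)%N ->
  D k (k * p.*2) = (-1) ^+ (k * p) * ('X * 'Y) ^+ (k * p * (k * p.*2 - k.+1))
                   * Pmk (k * p.*2) k.
Proof.
move=> k0; rewrite (shifted_even_diag path_gf0 path_gfS nz2_ZXY nzXY) //.
rewrite lucas_even_Pmk // det_unshifted // -[X in X * _ * _]signr_odd.
by rewrite oddM odd_double andbF mul1r mulrC.
Qed.

Lemma det_even_next (k p : nat) : (0 < k)%N ->
  D k (k * p.*2.+1)
  = (-1) ^+ (k * p + 'C(k.+1, 2) + k) * ('X * 'Y) ^+ (k * p * (k * p.*2.+1 - 1))
    * Pmk (k * p.*2) k.
Proof.
move=> k0; apply: (mulfI (expf_neq0 (k * p.*2) nzXY)).
rewrite (shifted_even_next path_gf0 path_gfS nz2_ZXY nzXY) //.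
rewrite lucas_even_Pmk // det_unshifted_next // -[X in X * _ * _]signr_odd.
(* The power s^(2pk) is set apart to match the multiplier introduced for cancellation. *)
have -> : (k * p * (k * p.*2.+1 + 1) = k * p.*2 + k * p * (k * p.*2.+1 - 1))%N.
  case: k k0 => // k _.
  by rewrite (_ : (k.+1 * p.*2.+1 - 1 = k.+1 * p.*2 + k)%N); lia.
rewrite oddM /= odd_double andbT signr_odd !exprD; ring.
Qed.

Lemma det_odd_diag (k p : nat) : (1 < k)%N ->
  D k (k * p.*2.+1).+1
  = (-1) ^+ (k * p + 'C(k.+1, 2)) * ('X * 'Y) ^+ (k * p * (k * p.*2.+1 + 1))
    * Pmk (k * p.*2.+1).+1 k.
Proof.
move=> k1; rewrite (shifted_odd_diag path_gf0 path_gfS nz2_ZXY nzXY) //.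
rewrite lucas_odd_Pmk // det_unshifted_next ?(ltnW k1) // -[X in X * _ * _]signr_odd.
by rewrite oddS oddM oddS odd_double andbT -oddS signr_odd signrMK mulrC.
Qed.

Lemma det_odd_next (k p : nat) : (1 < k)%N ->
  D k (k * p.+1.*2).-1
  = (-1) ^+ (k * p).+1 * ('X * 'Y) ^+ (k * p.+1 * (k * p.+1.*2 - k.+1) - k * p.*2.+1)
    * Pmk (k * p.*2.+1).+1 k.
Proof.
move=> k1; have k0 := ltnW k1.
have nz : - ('X * 'Y) ^+ (k * p.*2.+1) != 0 :> ZXY by rewrite oppr_eq0 expf_neq0 ?nzXY.
apply: (mulfI nz); rewrite (shifted_odd_next path_gf0 path_gfS nz2_ZXY nzXY) //.
rewrite lucas_odd_Pmk // det_unshifted //.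
(* The subtraction in the exponent is a true one for k at least 2, so the power of s contains the
   multiplier used above. *)
have le : (k * p.*2.+1 <= k * p.+1 * (k * p.+1.*2 - k.+1))%N.
  case: k k1 {k0 nz} => // -[] // k _.
  by rewrite (_ : (k.+2 * p.+1.*2 - k.+3 = k.+2 * p.*2 + k.+1)%N); lia.
rewrite -{1}(subnKC le) exprD.
rewrite -[(-1) ^+ _.-1]signr_odd.
have -> : odd (k * p.+1.*2).-1.
  by apply: negbNE; rewrite -oddS prednK ?muln_gt0 ?k0 // oddM odd_double andbF.
have -> : (-1) ^+ (k * p.+1) = (-1) ^+ (k * p) * (-1) ^+ k :> ZXY.
  by rewrite mulnSr exprD.
by rewrite -[RHS](signrMK k) !exprS; ring.
Qed.

End ShiftedPaths.

Lemma shifted_moments_hankel (n : nat) (k : int) :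
  \matrix_(i < n, j < n) path_gf (i + j + 1) 0 k = hankel (fun i => path_gf i.+1 0 k) n.
Proof. by apply/matrixP=> i j; rewrite !mxE addn1. Qed.

Theorem theorem4 (n : nat) (hn : (0 < n)%N) :
  (forall k : nat, (2 <= k)%N ->
    let D : ZXY := \det (\matrix_(i < n, j < n) path_gf (i + j + 1) 0 k%:Z) in
    (forall n1 : nat, (0 < n1)%N -> n = (2 * k * n1 - 1)%N ->
       D = (-1) ^ (k%:Z * (n1%:Z - 1) - 1)
           * ('X * 'Y) ^ (k%:Z * n1%:Z * (2 * k%:Z * n1%:Z - k%:Z - 3) + k%:Z)
           * Pmk (n - k + 2) k)
    /\ (forall n1 : nat, (0 < n1)%N -> n = (2 * k * n1 - k + 1)%N ->
       D = (-1) ^+ (k * n1 + 'C(k, 2))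
           * ('X * 'Y) ^+ (k * (n1 - 1) * (2 * k * n1 - k + 1))
           * Pmk n k)
    /\ (forall n1 : nat, (0 < n1)%N -> n = (2 * k * n1 - k)%N ->
       D = (-1) ^+ (k * n1 + 'C(k + 1, 2))
           * ('X * 'Y) ^+ (k * (n1 - 1) * (2 * k * n1 - k - 1))
           * Pmk (n - k) k)
    /\ (forall n1 : nat, (0 < n1)%N -> n = (2 * k * n1)%N ->
       D = (-1) ^+ (k * n1)
           * ('X * 'Y) ^+ (k * n1 * (2 * k * n1 - k - 1))
           * Pmk n k)
    /\ ((n %% (2 * k))%N \notin [:: 0; k; k + 1; 2 * k - 1]%N -> D = 0))
  /\ (let D : ZXY := \det (\matrix_(i < n, j < n) path_gf (i + j + 1) 0 1) in
      (forall n1 : nat, (0 < n1)%N -> n = (2 * n1)%N ->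
         D = (-1) ^+ n1 * ('X * 'Y) ^+ (2 * n1 * (n1 - 1))
             * (('X ^+ (n + 1) + (-1) ^+ n * 'Y ^+ (n + 1)) %/ ('X + 'Y)))
      /\ (forall n1 : nat, (0 < n1)%N -> n = (2 * n1 - 1)%N ->
         D = (-1) ^+ (n1 + 1) * ('X * 'Y) ^+ (2 * (n1 - 1) ^ 2)
             * (('X ^+ n + (-1) ^+ (n - 1) * 'Y ^+ n) %/ ('X + 'Y))))
  /\ \det (\matrix_(i < n, j < n) path_gf (i + j + 1) 0 0)
     = 2%:R ^+ (n - 1) * ('X * 'Y) ^+ 'C(n, 2) * ('X ^+ n + 'Y ^+ n) :> ZXY.
Proof.
have Pm1 m : Pmk m 1 = ('X ^+ (m + 1) + (-1) ^+ m * 'Y ^+ (m + 1)) %/ ('X + 'Y).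
  by rewrite /Pmk divn1 dvd1n.
split=> [k k2 D|]; last split=> [D|].
- have k0 := ltnW k2; rewrite {}/D shifted_moments_hankel.
  split; last split; last split; last split.
  + case=> // p _ nE.
    have -> : (n - k + 2 = (k * p.*2.+1).+1)%N by lia.
    have -> : n = (k * p.+1.*2).-1 by lia.
    rewrite det_odd_next //; congr (_ * _ * _).
      (* For n1 = 1 the integer exponent is -1, so the inverse of -1 is split off. *)
      rewrite exprzDr ?unitrN1 // -[_ ^ -1]/((-1)^-1) invrN1 mulrN1 exprS mulN1r.
      by rewrite (_ : k%:Z * (p.+1%:Z - 1) = (k * p)%N) //; lia.
    (* The exponents agree since k n1 (2 k n1 - k - 3) + k = k n1 (2 k n1 - k - 1) - k (2 n1 -
       1). *)
    rewrite exprnP; congr (_ ^ _).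
    case: k k2 {k0 nE} => // -[] // k _.
    by rewrite (_ : (k.+2 * p.+1.*2 - k.+3 = k.+2 * p.*2 + k.+1)%N); lia.
  + case=> // p _ nE; have {nE} -> : n = (k * p.*2.+1).+1 by lia.
    rewrite det_odd_diag //; congr (_ * _ ^+ (_ * _) * _); try lia.
    rewrite -signr_odd -[RHS]signr_odd; congr (_ ^+ nat_of_bool _).
    by rewrite binS bin1; lia.
  + case=> // p _ nE; have -> : (n - k = k * p.*2)%N by lia.
    have {nE} -> : n = (k * p.*2.+1)%N by lia.
    rewrite det_even_next //; congr (_ ^+ _ * _ ^+ (_ * _) * _); rewrite ?addn1; lia.
  + case=> // p _ nE; have {nE} -> : n = (k * p.+1.*2)%N by lia.
    rewrite det_even_diag //; congr (_ * _ ^+ (_ * _) * _); lia.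
  + by move=> nk; exact: (shifted_eq0 path_gf0 path_gfS nz2_ZXY nzXY k0 nk).
(* For k = 1 the two families coming from E already cover even and odd n. *)
- rewrite {}/D shifted_moments_hankel; split.
  + case=> // p _ nE; have {nE} -> : n = (1 * p.+1.*2)%N by lia.
    rewrite det_even_diag // Pm1; congr (_ ^+ _ * _ ^+ _ * _); lia.
  + case=> // p _ nE; have {nE} -> : n = (1 * p.*2.+1)%N by lia.
    rewrite det_even_next // Pm1 !mul1n subn1 !addn1 /=.
    congr (_ ^+ _ * _ ^+ _ * _); rewrite ?binn ?subn1 -?mulnn /= ?addn1; lia.
by rewrite shifted_moments_hankel (shifted_zero path_gf0 path_gfS hn) subn1.
Qed.
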